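(* Let $A$ be a non-zero positive bounded operator on a complex Hilbert space $\mathscr{H}$ and let $B,C\in\mathbb{B}_A(\mathscr{H})$. Then $$\frac12 w_A(B^2+C^2)+\frac12\max\{w_A(B),w_A(C)\}\,\big|w_A(B+C)-w_A(B-C)\big|\le w_{A,e}^2(B,C)$$ and $$w_{A,e}^2(B,C)\le\frac1{\sqrt2}\,w_A\big((B^\sharp B+C^\sharp C)+i(BB^\sharp+CC^\sharp)\big).$$
   Context: $\mathbb{B}(\mathscr{H})$ is the algebra of bounded linear operators on $\mathscr{H}$. For $x,y\in\mathscr{H}$, $\langle x,y\rangle_A=\langle Ax,y\rangle$ and $\|x\|_A=\langle Ax,x\rangle^{1/2}$. $\mathbb{B}_A(\mathscr{H})$ is the set of $T\in\mathbb{B}(\mathscr{H})$ that admit an $A$-adjoint, i.e. for which there is $S\in\mathbb{B}(\mathscr{H})$ with $AS=T^*A$ (equivalently $\langle Tx,y\rangle_A=\langle x,Sy\rangle_A$ for all $x,y$). For $T\in\mathbb{B}_A(\mathscr{H})$, $T^\sharp$ is the unique solution $X\in\mathbb{B}(\mathscr{H})$ of $AX=T^*A$ whose range is contained in $\overline{\mathcal{R}(A)}$. The $A$-numerical radius is $w_A(T)=\sup\{|\langle Tx,x\rangle_A|: \|x\|_A=1\}$, and the $A$-Euclidean operator radius of a pair is $w_{A,e}(B,C)=\sup\{(|\langle Bx,x\rangle_A|^2+|\langle Cx,x\rangle_A|^2)^{1/2}: \|x\|_A=1\}$; $w_{A,e}^2(B,C)$ means $(w_{A,e}(B,C))^2$.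 *)

(* Defs.v *)
From mathcomp Require Import all_boot all_order all_algebra.
From mathcomp Require Import complex.
From mathcomp Require Import boolp classical_sets functions reals.
From mathcomp Require Import topology normedtype.
Set Implicit Arguments.
Unset Strict Implicit.
Unset Printing Implicit Defensive.
Import Order.TTheory GRing.Theory Num.Theory Num.Def.
Import numFieldNormedType.Exports.
Local Open Scope classical_set_scope.
Local Open Scope complex_scope.
Local Open Scope ring_scope.

(* The complex scalars are [R[i]].  A complex Hilbert space is a complete
   normed [R[i]]-module [H] together with an inner product
   [dot : {dot H for conjC}] (linear in the first argument, positive definite)
   that induces the norm of [H]. *)
Definition induces_norm (R : realType) (H : normedModType R[i])
    (dot : {dot H for conjC}) : Prop :=
  forall x : H, `|x| ^+ 2 = dot x x.

(* B(H); [linear_boundedP] turns boundedness near 0 into [`|T x| <= r * `|x|]. *)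
Definition bounded_operator (R : realType) (H : normedModType R[i])
    (T : H -> H) : Prop :=
  linear T /\ bounded_near T (nbhs (0 : H)).

Definition positive_operator (R : realType) (H : normedModType R[i])
    (dot : {dot H for conjC}) (T : H -> H) : Prop :=
  bounded_operator T /\ forall x : H, 0 <= dot (T x) x.

(* The Hilbert adjoint T^*: exactly one such [S] exists for [T] in B(H), by the
   Riesz representation theorem. *)
Definition adjoint (R : realType) (H : normedModType R[i])
    (dot : {dot H for conjC}) (T : H -> H) : H -> H :=
  xget (0 : H -> H) [set S | bounded_operator S /\
    forall x y : H, dot (T x) y = dot x (S y)].

Section A_structure.
Context (R : realType) (H : normedModType R[i]).
Context (dot : {dot H for conjC}) (A : H -> H).

Definition dotA (x y : H) : R[i] := dot (A x) y.

(* For positive [A] the number [dotA x x] is real and nonnegative. *)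
Definition normA (x : H) : R := Num.sqrt (complex.Re (dotA x x)).

Definition sphereA : set H := [set x | normA x = 1].

Definition A_adjointable (T : H -> H) : Prop :=
  bounded_operator T /\
  exists2 S : H -> H, bounded_operator S & A \o S = adjoint dot T \o A.

(* For [A] positive and [T] in B_A(H) exactly one such [X] exists: compose any
   A-adjoint with the orthogonal projection onto the closure of the range of [A].
   The default value of [xget] is not used. *)
Definition sharp (T : H -> H) : H -> H :=
  xget (0 : H -> H) [set X | [/\ bounded_operator X,
    A \o X = adjoint dot T \o A &
    range X `<=` closure (range A)]].

(* The modulus [`|z|] of [z : R[i]] lives in [R[i]]; [complex.Re] reads it in [R].
   The suprema below are over sets bounded above when the operators are
   A-adjointable, and nonempty when moreover [A != 0]; outside of that [sup] may
   take its default value 0. *)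
Definition w_A (T : H -> H) : R :=
  sup [set complex.Re `|dotA (T x) x| | x in sphereA].

Definition w_Ae (B C : H -> H) : R :=
  sup [set Num.sqrt (complex.Re `|dotA (B x) x| ^+ 2 +
                     complex.Re `|dotA (C x) x| ^+ 2) | x in sphereA].

End A_structure.

(* Main.v *)
(** Everything but the existence of adjoints is elementary for the semi-inner
product <x, y>_A = <A x, y>.

Lower bound: with p = w_A(B + C) and r = w_A(B - C), the inequality
(|b| + |c|)^2 <= 2 (|b|^2 + |c|^2) gives max(p, r)^2 <= 2 w_{A,e}^2(B, C), that is
w_{A,e}^2(B, C) >= (p^2 + r^2)/4 + (p + r) |p - r|/4.  Since
2 (B^2 + C^2) = (B + C)^2 + (B - C)^2, the power inequality w_A(T^2) <= w_A(T)^2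
bounds w_A(B^2 + C^2) by (p^2 + r^2)/2, and 2 B, 2 C = (B + C) +/- (B - C) bound
max(w_A(B), w_A(C)) by (p + r)/2.

Upper bound: for ||x||_A = 1, |<T x, x>_A|^2 is at most both ||T x||_A^2 and
||T^sharp x||_A^2, hence at most their mean; these squared seminorms add up to the
real and imaginary parts of the quadratic form on the right-hand side.

The suprema are finite because an A-adjointable operator is bounded for ||.||_A,
and T^sharp exists by the Riesz theorem and orthogonal projection onto the closure
of the range of A.  Both are instances of one minimization over a closed subspace. *)

Require Import Defs.
From HB Require Import structures.
From mathcomp Require Import all_boot all_order all_algebra.
From mathcomp Require Import complex.
From mathcomp Require Import boolp classical_sets functions reals.
From mathcomp Require Import topology normedtype.
From mathcomp Require Import ring lra.
Set Implicit Arguments.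
Unset Strict Implicit.
Unset Printing Implicit Defensive.
Import Order.TTheory GRing.Theory Num.Theory Num.Def.
Import numFieldNormedType.Exports.
Local Open Scope classical_set_scope.
Local Open Scope complex_scope.
Local Open Scope ring_scope.

Local Notation Re := complex.Re.
Local Notation Im := complex.Im.

(** * Real-valued modulus and coordinates of complex numbers *)

Section Modulus.
Variable R : rcfType.
Implicit Types z t : R[i].

Lemma modulusE z : `|z| = (Re `|z|)%:C.
Proof. by rewrite normc_def. Qed.

Lemma modulus_ge0 z : 0 <= Re `|z|.
Proof. by rewrite -ler0c -modulusE. Qed.

Lemma sqr_modulus z : Re `|z| ^+ 2 = Re z ^+ 2 + Im z ^+ 2.
Proof. by rewrite normc_def /= sqr_sqrtr // addr_ge0 ?sqr_ge0. Qed.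

Lemma modulusM z t : Re `|z * t| = Re `|z| * Re `|t|.
Proof. by rewrite normrM (modulusE z) (modulusE t) -rmorphM. Qed.

Lemma modulusD z t : Re `|z + t| <= Re `|z| + Re `|t|.
Proof.
have := ler_normD z t.
by rewrite (modulusE z) (modulusE t) (modulusE (z + t)) -rmorphD lecR.
Qed.

Lemma ReD z t : Re (z + t) = Re z + Re t.
Proof. by case: z t => [a b] [c d]. Qed.

Lemma ImD z t : Im (z + t) = Im z + Im t.
Proof. by case: z t => [a b] [c d]. Qed.

Lemma ReM z t : Re (z * t) = Re z * Re t - Im z * Im t.
Proof. by case: z t => [a b] [c d]. Qed.

Lemma ImM z t : Im (z * t) = Re z * Im t + Im z * Re t.
Proof. by case: z t => [a b] [c d]. Qed.

Lemma ReN z : Re (- z) = - Re z.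
Proof. by case: z. Qed.

Lemma ImN z : Im (- z) = - Im z.
Proof. by case: z. Qed.

Lemma ReJ z : Re (conjC z) = Re z.
Proof. by case: z. Qed.

Lemma ImJ z : Im (conjC z) = - Im z.
Proof. by case: z. Qed.

Definition ReImE := (ReD, ImD, ReM, ImM, ReN, ImN, ReJ, ImJ).

Lemma Re_le_modulus z : Re z <= Re `|z|.
Proof.
rewrite (le_trans (ler_norm _)) // -ler_sqr ?nnegrE ?modulus_ge0 //.
by rewrite sqr_modulus real_normK ?num_real // lerDl sqr_ge0.
Qed.

Lemma complex_eq z t : Re z = Re t -> Im z = Im t -> z = t.
Proof. by case: z t => [a b] [c d] /= -> ->. Qed.

End Modulus.

(** * Linearity of unbundled maps *)

Section LinearFacts.
Variables (K : nzRingType) (V W : lmodType K) (T : V -> W).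
Hypothesis Tl : linear T.

Lemma linear_add u v : T (u + v) = T u + T v.
Proof. by have := Tl 1 u v; rewrite !scale1r. Qed.

Lemma linear_zero : T 0 = 0.
Proof. by apply: (addIr (T 0)); rewrite -linear_add !add0r. Qed.

Lemma linear_scale a u : T (a *: u) = a *: T u.
Proof. by have := Tl a u 0; rewrite linear_zero !addr0. Qed.

Lemma linear_opp u : T (- u) = - T u.
Proof. by rewrite -scaleN1r linear_scale scaleN1r. Qed.

End LinearFacts.

(** * Semi-inner products *)

Section SemiInner.
Variables (R : realType) (V : lmodType R[i]).

Definition semi_inner (g : V -> V -> R[i]) : Prop :=
  [/\ forall a u v w, g (a *: u + v) w = a * g u w + g v w,
      forall u v, g v u = conjC (g u v) &
      forall u, 0 <= g u u].

Variables (g : V -> V -> R[i]) (gP : semi_inner g).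

Local Notation q x := (Re (g x x)).

Lemma siC u v : g v u = conjC (g u v). Proof. by case: gP. Qed.

Lemma si0 u : g 0 u = 0.
Proof.
case: gP => gl _ _; have := gl 1 0 0 u; rewrite scaler0 addr0 mul1r => /eqP.
by rewrite -subr_eq subrr eq_sym => /eqP.
Qed.

Lemma siDl u v w : g (u + v) w = g u w + g v w.
Proof. by case: gP => gl _ _; rewrite -[u]scale1r gl mul1r scale1r. Qed.

Lemma siZl a u w : g (a *: u) w = a * g u w.
Proof. by case: gP => gl _ _; rewrite -[a *: u]addr0 gl si0 addr0. Qed.

Lemma siNl u w : g (- u) w = - g u w.
Proof. by rewrite -scaleN1r siZl mulN1r. Qed.

Lemma siDr u v w : g w (u + v) = g w u + g w v.
Proof. by rewrite siC siDl rmorphD /= -!siC. Qed.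

Lemma siZr a u w : g w (a *: u) = conjC a * g w u.
Proof. by rewrite siC siZl rmorphM /= -!siC. Qed.

Lemma siNr u w : g w (- u) = - g w u.
Proof. by rewrite siC siNl rmorphN /= -!siC. Qed.

Lemma q_ge0 u : 0 <= q u.
Proof. by case: gP => _ _ /(_ u); rewrite lecE => /andP[]. Qed.

Lemma si_diag u : g u u = (q u)%:C.
Proof.
by apply: complex_eq => //=; apply: ger0_Im; case: gP.
Qed.

Lemma qD u v : q (u + v) = q u + q v + 2 * Re (g u v).
Proof. by rewrite siDl !siDr (siC u v) !ReImE; ring. Qed.

Lemma qZ a u : q (a *: u) = Re `|a| ^+ 2 * q u.
Proof. by rewrite siZl siZr sqr_modulus si_diag !ReImE /=; ring. Qed.

(** Splitting the coefficient into a real step [s] and a direction [c] gives a quadratic polynomial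
    in [s]. It serves Cauchy-Schwarz and, later, the near-minimizers of the Riesz functional. *)
Lemma si_variation u v (c : R[i]) (s : R) :
  q (u - (s%:C * c) *: v) =
  q u - 2 * s * Re (conjC c * g u v) + s ^+ 2 * Re `|c| ^+ 2 * q v.
Proof.
rewrite -scaleNr qD qZ siZr !sqr_modulus !ReImE /=; ring.
Qed.

Lemma CauchySchwarz_si u v : Re `|g u v| ^+ 2 <= q u * q v.
Proof.
set c := g u v; set N := Re `|c| ^+ 2.
have N0 : 0 <= N by rewrite sqr_ge0.
have H s : 0 <= q u - 2 * s * N + s ^+ 2 * N * q v.
  have := q_ge0 (u - (s%:C * c) *: v); rewrite si_variation.
  suff -> : Re (conjC c * g u v) = N by [].
  by rewrite /N sqr_modulus !ReImE -/c; ring.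
have [v0|v0] := eqVneq (q v) 0.
  rewrite v0 mulr0; have [->//|Nn] := eqVneq N 0.
  (* For [q v = 0] the polynomial is affine in [s], and this choice gives it the value -1. *)
  have := H ((q u + 1) / (2 * N)); rewrite v0 mulr0 addr0.
  have -> : 2 * ((q u + 1) / (2 * N)) * N = q u + 1 by field.
  by lra.
(* The minimizer of the polynomial in [s]. *)
have := H (q v)^-1.
have -> : q u - 2 * (q v)^-1 * N + (q v)^-1 ^+ 2 * N * q v = (q u * q v - N) / q v.
  by field.
by rewrite pmulr_lge0 ?invr_gt0 ?lt_def ?v0 ?q_ge0 // subr_ge0.
Qed.

(* With [u = (N + T) x] and [v = (N - T) x] both [(N - T) u] and [(N + T) v]
   equal [(N^2 - T^2) x], while [u + v = 2 N x]. *)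
Lemma numerical_bound_sqr_Re (T : V -> V) (N : R) : linear T -> 0 < N ->
    (forall x, Re `|g (T x) x| <= N * q x) ->
  forall x, Re (g (T (T x)) x) <= N ^+ 2 * q x.
Proof.
move=> Tl N0 TN x.
have TD := linear_add Tl; have TZ := linear_scale Tl; have TNN := linear_opp Tl.
set n := N%:C; set u := n *: x + T x; set v := n *: x - T x.
have hu : Re (g (T u) u) <= N * q u := le_trans (Re_le_modulus _) (TN u).
have hv : - Re (g (T v) v) <= N * q v.
  apply: le_trans (TN v); rewrite -ReN -[X in _ <= Re X]normrN; exact: Re_le_modulus.
have : 0 <= Re (g (n *: u - T u) u) + Re (g (n *: v + T v) v).
  rewrite !siDl siNl !siZl (si_diag u) (si_diag v) !ReImE /=; lra.
have Eu : n *: u - T u = (n * n) *: x - T (T x).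
  by rewrite /u !TD !TZ scalerDr scalerA opprD addrA addrK.
have -> : n *: v + T v = n *: u - T u.
  by rewrite Eu /v !TD TNN !TZ scalerDr scalerN scalerA subrKA.
rewrite -ReD -siDr.
have -> : u + v = (2 * n) *: x
  by rewrite /u /v addrACA subrr addr0 -mulr2n -scaler_nat scalerA.
rewrite Eu siZr siDl siNl siZl si_diag !ReImE /=.
set e := Re (g (T _) x) => Hs.
have : 0 <= (2 * N) * (N ^+ 2 * q x - e).
  apply: le_trans Hs _; rewrite le_eqVlt; apply/orP; left; apply/eqP; ring.
by rewrite pmulr_rge0 ?mulr_gt0// subr_ge0.
Qed.

(** Replacing [T] by [c *: T] multiplies [T (T x)] by [c * c], so it is the square of a unit number
    that has to turn [z] onto the nonnegative half-line. *)
Lemma unit_sqr_rotation (z : R[i]) :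
  exists2 c : R[i], Re `|c| = 1 & c * c * z = `|z|.
Proof.
have [->|z0] := eqVneq z 0; first by exists 1; rewrite ?normr0 ?mulr0 ?normr1.
exists (sqrtC (`|z| / z)).
  apply/eqP; rewrite -sqrp_eq1 ?modulus_ge0 // expr2 -modulusM -expr2 sqrtCK.
  by rewrite normrM normfV normr_id divff ?normr_eq0.
by rewrite -expr2 sqrtCK divfK.
Qed.

(** A unit factor preserves the hypothesis. Applied to [c *: T], with [c] chosen for the given [x],
    the bound on the real part becomes one on the modulus. *)
Lemma numerical_bound_sqr (T : V -> V) (N : R) : linear T -> 0 < N ->
    (forall x, Re `|g (T x) x| <= N * q x) ->
  forall x, Re `|g (T (T x)) x| <= N ^+ 2 * q x.
Proof.
move=> Tl N0 TN x; have [c c1 cz] := unit_sqr_rotation (g (T (T x)) x).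
rewrite -cz.
have := @numerical_bound_sqr_Re (fun y => c *: T y) N _ N0 _ x.
rewrite (linear_scale Tl) scalerA siZl; apply.
  by move=> a y z; rewrite Tl scalerDr !scalerA mulrC.
by move=> y; rewrite siZl modulusM c1 mul1r.
Qed.

End SemiInner.

(** * Riesz representation and projections *)

Lemma norm_realE (R : realType) (V : normedModType R[i]) (x : V) :
  `|x| = (Re `|x|)%:C.
Proof. by rewrite RRe_real // normr_real. Qed.

Lemma norm_ltE (R : realType) (V : normedModType R[i]) (x : V) (e : R) :
  (`|x| < e%:C) = (Re `|x| < e).
Proof. by rewrite norm_realE ltcR. Qed.

Lemma gt0_realE (R : realType) (e : R[i]) : 0 < e -> e = (Re e)%:C.
Proof. by move=> e0; rewrite RRe_real // gtr0_real. Qed.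

Lemma closure_normP (R : realType) (V : normedModType R[i]) (S : set V) (x : V) :
  closure S x <-> forall e : R, 0 < e -> exists2 y, S y & Re `|x - y| < e.
Proof.
split=> [cSx e e0|Sx U].
  have : nbhs x (ball x e%:C) by apply: nbhsx_ballx; rewrite ltcR.
  by move=> /cSx[y [Sy]]; rewrite -ball_normE /= norm_ltE; exists y.
move=> /nbhs_ballP[e /= e0]; rewrite (gt0_realE e0) => eU.
have [|y Sy xy] := Sx (Re e); first by rewrite -ltcR -gt0_realE.
by exists y; split => //; apply: eU; rewrite -ball_normE /= norm_ltE.
Qed.

Lemma cauchy_limit (R : realType) (V : completeNormedModType R[i]) (u : nat -> V) :
    (forall e : R, 0 < e -> exists N, forall n, (N <= n)%N -> Re `|u N - u n| < e) ->
  exists m, forall e : R, 0 < e -> exists N, forall n, (N <= n)%N -> Re `|m - u n| < e.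
Proof.
move=> uC; have : cauchy (u @ \oo).
  apply: cauchy_exP => e /= e0; have [|N uN] := uC (Re e).
    by rewrite -ltcR -gt0_realE.
  exists (u N); exists N => // n /= /uN.
  by rewrite -ball_normE /= (gt0_realE e0) norm_ltE.
move=> /cauchy_cvg/cvgrPdist_lt uL; exists (lim (u @ \oo)) => e e0.
have [|N _ uN] := uL e%:C; first by rewrite ltcR.
by exists N => n /uN; rewrite norm_ltE.
Qed.

Section Hilbert.
Variables (R : realType) (H : completeNormedModType R[i]) (dot : {dot H for conjC}).
Hypothesis dot_norm : induces_norm dot.

Local Notation nrm x := (Re `|x|).

Lemma dot_semi_inner : semi_inner dot.
Proof.
split=> [a u v w|u v|u]; last exact: dnorm_ge0.
  by rewrite linearDl linearZl_LR.
by rewrite hermC expr0 mul1r.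
Qed.
Local Notation dotP := dot_semi_inner.

Lemma nrm_ge0 (x : H) : 0 <= nrm x.
Proof. by rewrite -ler0c -norm_realE. Qed.

Lemma nrm_sqr (x : H) : nrm x ^+ 2 = Re (dot x x).
Proof. by rewrite -dot_norm norm_realE expr2 ReImE /= mulr0 subr0. Qed.

Lemma CauchySchwarz_dot (u v : H) : Re `|dot u v| <= nrm u * nrm v.
Proof.
rewrite -ler_sqr ?nnegrE ?modulus_ge0 ?mulr_ge0 ?nrm_ge0 //.
by rewrite exprMn !nrm_sqr; exact: CauchySchwarz_si dotP _ _.
Qed.

Lemma dot_eq0 (x : H) : (forall v, dot v x = 0) -> x = 0.
Proof. by move=> /(_ x)/eqP; rewrite dnorm_eq0 => /eqP. Qed.

Lemma dot_inj (x y : H) : (forall v, dot v x = dot v y) -> x = y.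
Proof.
move=> xy; apply/eqP; rewrite -subr_eq0; apply/eqP/dot_eq0 => v.
by rewrite (siDr dotP) (siNr dotP) xy subrr.
Qed.

(* A bounded linear functional [f] on the closed subspace [M] is represented by
   the minimizer of [|v|^2 - 2 Re (f v)] over [M]: minimizing sequences are Cauchy
   by the parallelogram identity. *)
Section Riesz.
Variables (M : set H) (f : H -> R[i]) (K : R).
Hypotheses (M0 : M 0) (ML : forall a u v, M u -> M v -> M (a *: u + v)).
Hypothesis Mclosed : closure M `<=` M.
Hypothesis fL : forall a u v, f (a *: u + v) = a * f u + f v.
Hypothesis fK : forall v, Re `|f v| <= K * nrm v.

Let J v := nrm v ^+ 2 - 2 * Re (f v).

Let f0 : f 0 = 0.
Proof.
by apply: (addIr (f 0)); have := fL 1 0 0; rewrite scaler0 addr0 mul1r add0r => <-.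
Qed.
Let fD u v : f (u + v) = f u + f v.
Proof. by have := fL 1 u v; rewrite scale1r mul1r. Qed.
Let fZ a u : f (a *: u) = a * f u.
Proof. by have := fL a u 0; rewrite f0 !addr0. Qed.
Let fN u : f (- u) = - f u.
Proof. by rewrite -scaleN1r fZ mulN1r. Qed.

Let MZ a u : M u -> M (a *: u).
Proof. by move=> Mu; rewrite -[_ *: _]addr0; apply: ML. Qed.

(** Completing the square: |v|^2 - 2 K |v| = (|v| - K)^2 - K^2. Hence the infimum of [J] is
    finite. *)
Let JK v : - K ^+ 2 <= J v.
Proof.
have h := le_trans (Re_le_modulus _) (fK v).
have := sqr_ge0 (nrm v - K); rewrite /J; nra.
Qed.

(** The linear part of [J] cancels at the midpoint, so the distance of two near-minimizers is
    controlled by their excess over the infimum. *)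
Let parallelogram u v :
  nrm (u - v) ^+ 2 = 2 * J u + 2 * J v - 4 * J ((2^-1 : R)%:C *: (u + v)).
Proof.
rewrite /J !nrm_sqr (qZ dotP) sqr_modulus !(qD dotP) (siNl dotP) (siNr dotP).
rewrite (siNr dotP) fZ fD !ReImE /=; field; done.
Qed.

Let d := inf [set J v | v in M].

Let J_has_inf : has_inf [set J v | v in M].
Proof.
split; first by exists (J 0); exists 0.
by exists (- K ^+ 2) => _ [v _ <-].
Qed.

Let dJ v : M v -> d <= J v.
Proof. by move=> Mv; apply: ge_inf; [case: J_has_inf | exists v]. Qed.

(** Moving [u] along [v] with coefficient [conjC c / q], the best step against the residual [c],
    lowers [J] by |c|^2 / |v|^2, which cannot exceed the excess [e]. *)
Let almost_min (u : H) (e : R) : M u -> J u <= d + e -> forall v, M v ->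
  Re `|f v - dot v u| ^+ 2 <= e * nrm v ^+ 2.
Proof.
move=> Mu Ju v Mv; set c := f v - dot v u.
have [v0|v0] := eqVneq v 0.
  by rewrite /c v0 f0 (si0 dotP) subrr !normr0 /= expr0n /= mulr0.
have q0 : 0 < nrm v ^+ 2.
  by rewrite nrm_sqr -ltcR -(si_diag dotP) dnorm_gt0.
set q := nrm v ^+ 2 in q0 *.
have := dJ (ML (- ((- q^-1)%:C * conjC c)) Mv Mu).
rewrite addrC /J nrm_sqr scaleNr (si_variation dotP) -!nrm_sqr -/q.
rewrite fD fN fZ.
set N := Re `|c| ^+ 2.
have -> : Re `|conjC c| ^+ 2 = N by rewrite /N !sqr_modulus !ReImE sqrrN.
have cN : Re (conjC c * f v) - Re (c * dot u v) = N.
  by rewrite /N sqr_modulus /c (siC dotP v u) !ReImE; ring.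
have qE : (- q^-1) ^+ 2 * N * q = N / q by field; rewrite gt_eqF.
have ReE : Re (f u - ((- q^-1)%:C * conjC c) * f v) =
           Re (f u) + q^-1 * Re (conjC c * f v).
  by rewrite !ReImE /=; ring.
rewrite qE conjCK addrC ReE -ler_pdivrMr // => dle.
have : N / q = q^-1 * Re (conjC c * f v) - q^-1 * Re (c * dot u v).
  by rewrite -mulrBr cN mulrC.
move: Ju dle; rewrite /J; lra.
Qed.

Lemma riesz_on : exists2 m, M m & forall v, M v -> f v = dot v m.
Proof.
have /choice[u uP] n : exists v, M v /\ J v <= d + n.+1%:R^-1.
  have [|_ [v Mv <-] /ltW Jv] := inf_adherent (_ : 0 < n.+1%:R^-1) J_has_inf.
    by rewrite invr_gt0.
  by exists v.
have uu n k : (n <= k)%N -> nrm (u n - u k) ^+ 2 <= 4 * n.+1%:R^-1.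
  move=> nk; rewrite parallelogram.
  have [Mn Jn] := uP n; have [Mk Jk] := uP k.
  have Mm : M ((2^-1 : R)%:C *: (u n + u k)).
    by apply: MZ; rewrite -[u n]scale1r; apply: ML.
  have := dJ Mm.
  have : k.+1%:R^-1 <= n.+1%:R^-1 :> R by rewrite lef_pV2 ?posrE// ler_nat.
  move: (n.+1%:R^-1) (k.+1%:R^-1) (J _) Jn Jk => a b j Jn Jk; lra.
have arch (e : R) : 0 < e -> exists N, forall n, (N <= n)%N -> n.+1%:R^-1 < e.
  move=> e0; exists (Num.truncn e^-1) => n Nn.
  rewrite invf_plt ?posrE // (lt_le_trans (truncnS_gt _)) // ler_nat //.
have [m mP] : exists m, forall e : R, 0 < e ->
    exists N, forall n, (N <= n)%N -> nrm (m - u n) < e.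
  (* This makes the bound 4 / (N + 1) of [uu] smaller than e^2. *)
  apply: cauchy_limit => e e0; have [|N NP] := arch (e ^+ 2 / 4).
    by rewrite divr_gt0 ?exprn_gt0.
  exists N => n Nn; rewrite -ltr_sqr ?nnegrE ?nrm_ge0 ?ltW //.
  apply: le_lt_trans (uu _ _ Nn) _; by rewrite mulrC -ltr_pdivlMr ?NP.
exists m => [|v Mv].
  apply: Mclosed; apply/closure_normP => e /mP[N] /(_ _ (leqnn _)).
  by exists (u N) => //; case: (uP N).
(* The residual at [u n] costs [e * nrm v] by [almost_min], and passing from [u n] to [m] costs as
   much again. The later choice of [e] divides by [nrm v + 1], which is positive even for
   [v = 0]. *)
suff fdot (e : R) : 0 < e -> nrm (f v - dot v m) <= 2 * e * nrm v.
  apply/eqP; rewrite -subr_eq0 -normr_eq0 modulusE eq_complex /= eqxx andbT.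
  rewrite eq_le modulus_ge0 andbT; apply/ler_addgt0Pl => e e0; rewrite addr0.
  have v1 : 0 < nrm v + 1 by rewrite ltr_wpDl ?nrm_ge0.
  have := fdot (e / (2 * (nrm v + 1))); rewrite divr_gt0 ?mulr_gt0 // => /(_ isT).
  move=> /le_trans; apply.
  have -> : 2 * (e / (2 * (nrm v + 1))) * nrm v = e * (nrm v / (nrm v + 1)).
    by field; rewrite gt_eqF.
  by rewrite ger_pMr // ler_pdivrMr // mul1r lerDl.
move=> e0; have [|N1 N1P] := arch (e ^+ 2); first by rewrite exprn_gt0.
have [N2 N2P] := mP e e0; set n := maxn N1 N2.
have [Mn Jn] := uP n.
have -> : f v - dot v m = (f v - dot v (u n)) - dot v (m - u n).
  by rewrite (siDr dotP) (siNr dotP) opprB addrA subrK.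
apply: le_trans (modulusD _ _) _; rewrite normrN.
have h1 : nrm (f v - dot v (u n)) <= e * nrm v.
  rewrite -ler_sqr ?nnegrE ?modulus_ge0 ?mulr_ge0 ?nrm_ge0 ?(ltW e0) // exprMn.
  apply: (almost_min Mn) => //; apply: le_trans Jn _; rewrite lerD2l.
  by apply/ltW/N1P/leq_maxl.
have h2 : nrm (dot v (m - u n)) <= e * nrm v.
  apply: le_trans (CauchySchwarz_dot _ _) _; rewrite mulrC ler_wpM2r ?nrm_ge0 //.
  by apply/ltW/N2P/leq_maxr.
lra.
Qed.

End Riesz.
End Hilbert.

(** * Bounded operators, Hilbert adjoints and orthogonal projections *)

Section Operators.
Variables (R : realType) (H : completeNormedModType R[i]) (dot : {dot H for conjC}).
Hypothesis dot_norm : induces_norm dot.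

Local Notation nrm x := (Re `|x|).
Let dotP := dot_semi_inner dot.

Lemma bounded_operatorP (T : H -> H) :
  bounded_operator T <->
  linear T /\ exists2 K : R, 0 <= K & forall x, nrm (T x) <= K * nrm x.
Proof.
split=> -[Tl]; pose f : {linear H -> H} := HB.pack T (GRing.isLinear.Build _ _ _ _ T Tl).
  move=> /(linear_boundedP f)/pinfty_ex_gt0[K K0 TK]; split=> //.
  exists (Re K) => [|x]; first by rewrite ltW // -ltcR -gt0_realE.
  have := TK x; rewrite (gt0_realE K0) (norm_realE x) (norm_realE (f x)).
  by rewrite -rmorphM lecR.
move=> [K K0 TK]; split=> //; apply/(linear_boundedP f).
have : \forall r \near +oo, K%:C <= r.
  by apply: nbhs_pinfty_ge; rewrite ger0_real // ler0c.
apply: filterS => r Kr x; rewrite (le_trans _ (ler_wpM2r (normr_ge0 x) Kr)) //.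
by rewrite (norm_realE x) (norm_realE (f x)) -rmorphM lecR; exact: TK.
Qed.

Lemma bounded_operator_comp (S T : H -> H) :
  bounded_operator S -> bounded_operator T -> bounded_operator (S \o T).
Proof.
move=> /bounded_operatorP[Sl [K K0 SK]] /bounded_operatorP[Tl [L L0 TL]].
apply/bounded_operatorP; split=> [a u v|]; first by rewrite /= Tl Sl.
exists (K * L) => [|x /=]; first exact: mulr_ge0.
by rewrite (le_trans (SK _)) // -mulrA ler_wpM2l.
Qed.

Lemma adjoint_exists (T : H -> H) : bounded_operator T ->
  exists S, bounded_operator S /\ forall x y, dot (T x) y = dot x (S y).
Proof.
move=> /bounded_operatorP[Tl [K K0 TK]].
have /choice[S SP] y : exists m, forall x, dot (T x) y = dot x m.
  have [|||||m _ mP] := @riesz_on _ _ _ dot_norm setT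
    (fun x => dot (T x) y) (K * nrm y) => //.
  - by move=> a u v; rewrite Tl (siDl dotP) (siZl dotP).
  - move=> v; apply: le_trans (CauchySchwarz_dot dot_norm _ _) _.
    by rewrite mulrAC ler_wpM2r ?nrm_ge0.
  by exists m => x; apply: mP.
exists S; split=> [|x y]; last exact: SP.
apply/bounded_operatorP; split=> [a u v|].
  apply: (@dot_inj _ _ dot) => w; rewrite -SP !(siDr dotP) !(siZr dotP) -!SP.
  by [].
(* The bound follows from |S x|^2 = <T (S x), x> <= K |S x| |x| after division by |S x|. *)
exists K => // x; have [->|Sx0] := eqVneq (nrm (S x)) 0.
  by rewrite mulr_ge0 ?nrm_ge0.
have S0 : 0 < nrm (S x) by rewrite lt_def Sx0 nrm_ge0.
rewrite -(ler_pM2r S0) -expr2 (nrm_sqr dot_norm) -SP.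
apply: le_trans (Re_le_modulus _) _; apply: le_trans (CauchySchwarz_dot dot_norm _ _) _.
by rewrite mulrAC ler_wpM2r ?nrm_ge0.
Qed.

Lemma adjointP (T : H -> H) : bounded_operator T ->
  bounded_operator (adjoint dot T) /\
  forall x y, dot (T x) y = dot x (adjoint dot T y).
Proof. by move=> /adjoint_exists TS; exact: (xgetPex (0 : H -> H) TS). Qed.

Lemma adjointPl (T : H -> H) : bounded_operator T ->
  forall x y, dot (adjoint dot T x) y = dot x (T y).
Proof. by move=> /adjointP[_ TS] x y; rewrite (siC dotP) -TS -(siC dotP). Qed.

(** The projection of [x] is the vector that represents the functional [dot _ x] on [M]. *)
Lemma orthogonal_projection (M : set H) : M 0 ->
    (forall a u v, M u -> M v -> M (a *: u + v)) -> closure M `<=` M ->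
  exists P : H -> H, [/\ bounded_operator P, forall x, M (P x) &
    forall x v, M v -> dot v (P x) = dot v x].
Proof.
move=> M0 ML Mc.
have /choice[P PP] x : exists m, M m /\ forall v, M v -> dot v m = dot v x.
  have [|||||m Mm mP] := @riesz_on _ _ _ dot_norm M (fun v => dot v x) (nrm x) => //.
  - by move=> a u v; rewrite (siDl dotP) (siZl dotP).
  - by move=> v; rewrite mulrC; apply: CauchySchwarz_dot.
  by exists m; split=> // v Mv; rewrite mP.
have MP x : M (P x) by case: (PP x).
have dP x v : M v -> dot v (P x) = dot v x by case: (PP x) => _; apply.
exists P; split=> //; apply/bounded_operatorP; split=> [a u v|].
  (* The defect of linearity lies in [M] and is orthogonal to [M], hence to itself. *)
  apply/eqP; rewrite -subr_eq0 -(dnorm_eq0 dot); apply/eqP.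
  set w := P _ - _.
  have Mw : M w.
    rewrite /w -scaleN1r (addrC (P _)); apply: (ML); last exact: MP.
    by apply: (ML).
  rewrite {2}/w (siDr dotP) (siNr dotP) dP // !(siDr dotP) !(siZr dotP) !dP //.
  by rewrite subrr.
exists 1 => // x; rewrite mul1r; have [->|Px0] := eqVneq (nrm (P x)) 0.
  exact: nrm_ge0.
have P0 : 0 < nrm (P x) by rewrite lt_def Px0 nrm_ge0.
rewrite -(ler_pM2r P0) -expr2 (nrm_sqr dot_norm) dP // mulrC.
apply: le_trans (Re_le_modulus _) _; exact: CauchySchwarz_dot.
Qed.

Lemma closure_subspace (M : set H) : (forall a u v, M u -> M v -> M (a *: u + v)) ->
  forall a u v, closure M u -> closure M v -> closure M (a *: u + v).
Proof.
move=> ML a u v /closure_normP cu /closure_normP cv; apply/closure_normP => e e0.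
have a1 : 0 < 2 * (Re `|a| + 1) by rewrite mulr_gt0 // ltr_wpDl ?modulus_ge0.
have [|y My uy] := cu (e / (2 * (Re `|a| + 1))); first exact: divr_gt0.
have [|z Mz vz] := cv (e / 2); first exact: divr_gt0.
exists (a *: y + z); first exact: ML.
rewrite -norm_ltE opprD addrACA -scalerBr (le_lt_trans (ler_normD _ _)) //.
rewrite normrZ (norm_realE (u - y)) (norm_realE (v - z)) modulusE -rmorphM -rmorphD ltcR.
have : Re `|a| * nrm (u - y) <= e / 2.
  apply: (@le_trans _ _ (Re `|a| * (e / (2 * (Re `|a| + 1))))).
    by rewrite ler_wpM2l ?modulus_ge0 ?ltW.
  have -> : Re `|a| * (e / (2 * (Re `|a| + 1))) = e / 2 * (Re `|a| / (Re `|a| + 1)).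
    by field; move: a1; rewrite pmulr_rgt0 // => /gt_eqF ->.
  rewrite ger_pMr ?divr_gt0 // ler_pdivrMr ?mul1r ?lerDl //.
  by rewrite ltr_wpDl ?modulus_ge0.
move: (Re `|a| * _) => b ?; lra.
Qed.

(** * The form of a positive operator and the A-adjoint *)

Section Positive.
Variable A : H -> H.
Hypothesis A_pos : positive_operator dot A.

Let Al : linear A. Proof. by case: A_pos => -[]. Qed.

(** Polarization: the diagonal value at [u + v] is real, which settles the imaginary parts, and the
    one at [u + 'i *: v] settles the real parts. *)
Lemma positive_symmetric u v : dot (A v) u = conjC (dot (A u) v).
Proof.
have A_im x : Im (dot (A x) x) = 0 by apply: ger0_Im; case: A_pos.
have h1 := A_im (u + v); have h2 := A_im (u + 'i *: v).
rewrite (linear_add Al) !(siDl dotP) !(siDr dotP) !ReImE !A_im in h1.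
rewrite (linear_add Al) (linear_scale Al) in h2.
rewrite !(siDl dotP) !(siDr dotP) !(siZl dotP) !(siZr dotP) !ReImE !A_im /= in h2.
by apply: complex_eq; rewrite !ReImE; lra.
Qed.

Lemma dotA_semi_inner : semi_inner (dotA dot A).
Proof.
split=> [a u v w|u v|u]; rewrite /dotA; last by case: A_pos.
  by rewrite Al (siDl dotP) (siZl dotP).
exact: positive_symmetric.
Qed.

Lemma dot_positiveC u v : dot (A u) v = dot u (A v).
Proof. by rewrite positive_symmetric -(siC dotP). Qed.

Lemma sharpP (T : H -> H) : A_adjointable dot A T ->
  bounded_operator (sharp dot A T) /\
  forall x y, dotA dot A (sharp dot A T x) y = dotA dot A x (T y).
Proof.
move=> [Tb [S Sb AS]].
have [|||P [Pb PM dP]] := @orthogonal_projection (closure (range A)).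
- by apply: subset_closure; exists 0 => //; rewrite (linear_zero Al).
- apply: closure_subspace => a _ _ [u _ <-] [v _ <-].
  by exists (a *: u + v) => //; rewrite Al.
- by move=> x; rewrite -(proj1 (closure_id _) (@closed_closure _ _)).
(* By symmetry <v, A (P x)> = <A v, P x>, and [P x] and [x] have the same products with the vectors
   of the range of [A]. *)
have AP x : A (P x) = A x.
  apply: (@dot_inj _ _ dot) => v; rewrite -!dot_positiveC dP //.
  by apply: subset_closure; exists v.
have : exists X, [/\ bounded_operator X, A \o X = adjoint dot T \o A &
    range X `<=` closure (range A)].
  exists (P \o S); split; first exact: bounded_operator_comp.
    by rewrite -AS; apply/funext => x; rewrite /= AP.
  by move=> _ [x _ <-]; exact: PM.
move=> /(xgetPex (0 : H -> H)) [Xb AX _]; split=> // x y.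
rewrite /dotA; have /(congr1 (fun f => f x)) /= := AX.
by rewrite -/(sharp dot A T) => ->; rewrite adjointPl.
Qed.

End Positive.
End Operators.

(** * Numerical radii for a semi-inner product *)

Lemma bernoulli_ineq (R : realDomainType) (t : R) n :
  0 <= t -> 1 + n%:R * t <= (1 + t) ^+ n.
Proof.
move=> t0; elim: n => [|n IH]; first by rewrite expr0 mul0r addr0.
rewrite exprS; apply: le_trans (ler_wpM2l _ IH); last by rewrite addr_ge0.
have : 0 <= n%:R * t * t by rewrite !mulr_ge0.
by rewrite -natr1 mulrDl mul1r mulrDl mul1r mulrDr mulr1 (mulrC t (_ * t)) => ?; lra.
Qed.

(** Repeated squaring gives (b 0 / r)^(2^n) <= K for all [n]. A ratio above 1 would grow without
    bound by Bernoulli, so the constant [K] disappears from the conclusion. *)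
Lemma squaring_growth (R : archiRealFieldType) (b : nat -> R) (K r : R) :
    0 < r -> (forall n, 0 <= b n) -> (forall n, b n ^+ 2 <= b n.+1) ->
    (forall n, b n <= K * r ^+ (2 ^ n)) ->
  b 0%N <= r.
Proof.
move=> r0 b0 bS bK; rewrite leNgt; apply/negP => rb.
have b_exp n : b 0%N ^+ (2 ^ n) <= b n.
  elim: n => [|n IH]; first by rewrite expn0 expr1.
  rewrite expnSr exprM; apply: le_trans (bS n).
  by rewrite ler_sqr ?nnegrE ?exprn_ge0.
set t := b 0%N / r - 1.
have t0 : 0 < t by rewrite subr_gt0 ltr_pdivlMr // mul1r.
have tK n : n%:R * t <= K.
  have : (1 + t) ^+ (2 ^ n) <= K.
    rewrite /t addrC subrK expr_div_n ler_pdivrMr ?exprn_gt0 //.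
    exact: le_trans (b_exp n) (bK n).
  have := bernoulli_ineq (2 ^ n) (ltW t0) => h1 /(le_trans h1) h2.
  have : n%:R * t <= (2 ^ n)%:R * t by rewrite ler_pM2r // ler_nat ltnW // ltn_expl.
  move: (_ * t) (_ * t) h2 => a c; lra.
have := tK (Num.truncn (K / t)).+1.
by rewrite leNgt -ltr_pdivrMr // truncnS_gt.
Qed.

Section NumericalRadius.
Variables (R : realType) (H : normedModType R[i]) (dot : {dot H for conjC}).
Variable A : H -> H.
Local Notation g := (dotA dot A).
Local Notation q x := (Re (g x x)).
Hypothesis gP : semi_inner g.
Hypothesis unitA : exists x, q x = 1.

Definition A_bounded (T : H -> H) :=
  exists2 c, 0 <= c & forall x, q (T x) <= c * q x.

(** Stated on all vectors and not only on the unit sphere, it also makes the form vanish where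
    [q x = 0], where normalization is impossible. *)
Definition numerically_bounded (T : H -> H) :=
  exists c, forall x, Re `|g (T x) x| <= c * q x.

Lemma A_bounded_comp S T : A_bounded S -> A_bounded T -> A_bounded (S \o T).
Proof.
move=> [c c0 Sc] [d d0 Td]; exists (c * d) => [|x]; first exact: mulr_ge0.
by rewrite (le_trans (Sc _)) // -mulrA ler_wpM2l.
Qed.

Lemma A_bounded_numerically T : A_bounded T -> numerically_bounded T.
Proof.
move=> [c c0 Tc]; exists (Num.sqrt c) => x.
rewrite -ler_sqr ?nnegrE ?modulus_ge0 ?mulr_ge0 ?sqrtr_ge0 ?(q_ge0 gP) // exprMn sqr_sqrtr //.
rewrite (le_trans (CauchySchwarz_si gP _ _)) // expr2 mulrA ler_wpM2r ?(q_ge0 gP) //.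
Qed.

Lemma numerically_boundedD S T : numerically_bounded S -> numerically_bounded T ->
  numerically_bounded (S + T).
Proof.
move=> [c Sc] [d Td]; exists (c + d) => x.
by rewrite (siDl gP) mulrDl (le_trans (modulusD _ _)) // lerD.
Qed.

Lemma numerically_boundedZ (a : R[i]) T : numerically_bounded T ->
  numerically_bounded (a *: T).
Proof.
move=> [c Tc]; exists (Re `|a| * c) => x.
by rewrite (siZl gP) modulusM -mulrA ler_wpM2l ?modulus_ge0.
Qed.

Lemma numerically_boundedN T : numerically_bounded T -> numerically_bounded (- T).
Proof. by move=> [c Tc]; exists c => x; rewrite (siNl gP) normrN. Qed.

Lemma sphereAP x : sphereA dot A x <-> q x = 1.
Proof.
rewrite /sphereA /normA /=; split=> [n1|->]; last exact: sqrtr1.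
by rewrite -[LHS]sqr_sqrtr ?(q_ge0 gP) // n1 expr1n.
Qed.

Lemma w_A_le T (K : R) :
  (forall x, q x = 1 -> Re `|g (T x) x| <= K) -> w_A dot A T <= K.
Proof.
move=> TK; have [x x1] := unitA.
apply: ge_sup => [|_ [y /sphereAP y1 <-]]; last exact: TK.
by exists (Re `|g (T x) x|); exists x => //; apply/sphereAP.
Qed.

Lemma w_A_ge T x : numerically_bounded T -> q x = 1 ->
  Re `|g (T x) x| <= w_A dot A T.
Proof.
move=> [c Tc] x1; apply: ub_le_sup; last by exists x => //; apply/sphereAP.
by exists c => _ [y /sphereAP y1 <-]; have := Tc y; rewrite y1 mulr1.
Qed.

Lemma w_A_ge0 T : numerically_bounded T -> 0 <= w_A dot A T.
Proof.
by move=> Tc; have [x /(w_A_ge Tc)] := unitA; apply: le_trans; exact: modulus_ge0.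
Qed.

Lemma w_A_bound T x : linear T -> numerically_bounded T ->
  Re `|g (T x) x| <= w_A dot A T * q x.
Proof.
move=> Tl Tb; have [x0|x0] := eqVneq (q x) 0.
  by case: (Tb) => c /(_ x); rewrite x0 !mulr0.
have qx : 0 < q x by rewrite lt_def x0 (q_ge0 gP).
set s := (Num.sqrt (q x))^-1.
have s2 : s ^+ 2 = (q x)^-1 by rewrite exprVn sqr_sqrtr ?ltW.
have ns : Re `|s%:C| ^+ 2 = s ^+ 2 by rewrite sqr_modulus /= expr0n addr0.
have := @w_A_ge T (s%:C *: x) Tb.
rewrite (qZ gP) ns s2 mulVf // => /(_ erefl).
rewrite (linear_scale Tl) (siZl gP) (siZr gP) !modulusM mulrA.
have -> : Re `|s%:C| * Re `|conjC s%:C| = (q x)^-1 by rewrite norm_conjC -expr2 ns.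
by rewrite ler_pdivrMl // mulrC.
Qed.

Lemma w_Ae_ge B C x : numerically_bounded B -> numerically_bounded C -> q x = 1 ->
  Re `|g (B x) x| ^+ 2 + Re `|g (C x) x| ^+ 2 <= w_Ae dot A B C ^+ 2.
Proof.
move=> [b Bb] [c Cc] x1; set s := _ + _.
have s0 : 0 <= s by rewrite addr_ge0 ?sqr_ge0.
have : Num.sqrt s <= w_Ae dot A B C.
  apply: ub_le_sup; last by exists x => //; apply/sphereAP.
  exists (Num.sqrt (b ^+ 2 + c ^+ 2)) => _ [y /sphereAP y1 <-].
  have := Bb y; have := Cc y; rewrite y1 !mulr1 => cy byy.
  have le_sqr (z : R[i]) k : Re `|z| <= k -> Re `|z| ^+ 2 <= k ^+ 2.
    move=> zk; have z0 := modulus_ge0 z.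
    by rewrite ler_sqr ?nnegrE // (le_trans z0 zk).
  by apply/ler_wsqrtr/lerD; apply: le_sqr.
move=> sw; rewrite -(sqr_sqrtr s0) ler_sqr ?nnegrE ?sqrtr_ge0 //.
exact: le_trans (sqrtr_ge0 _) sw.
Qed.

Lemma w_Ae_sqr_le B C (K : R) :
    (forall x, q x = 1 -> Re `|g (B x) x| ^+ 2 + Re `|g (C x) x| ^+ 2 <= K) ->
  w_Ae dot A B C ^+ 2 <= K.
Proof.
move=> BCK; have [x x1] := unitA.
have K0 : 0 <= K by apply: le_trans (BCK x x1); rewrite addr_ge0 ?sqr_ge0.
have ubK : ubound [set Num.sqrt (Re `|g (B x) x| ^+ 2 + Re `|g (C x) x| ^+ 2) |
    x in sphereA dot A] (Num.sqrt K).
  by move=> _ [y /sphereAP y1 <-]; apply/ler_wsqrtr/BCK.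
have Sx := imageP (fun x => Num.sqrt (Re `|g (B x) x| ^+ 2 + Re `|g (C x) x| ^+ 2))
  (proj2 (sphereAP x) x1).
rewrite -(sqr_sqrtr K0) ler_sqr ?nnegrE ?sqrtr_ge0 //.
  by apply: ge_sup => //; eexists; exact: Sx.
(* Comparing squares requires the supremum to be nonnegative; it dominates the value at [x]. *)
apply: le_trans (sqrtr_ge0 _) (ub_le_sup _ Sx).
by exists (Num.sqrt K).
Qed.

Lemma w_A_sqr T : linear T -> numerically_bounded T ->
  forall x, q x = 1 -> Re `|g (T (T x)) x| <= w_A dot A T ^+ 2.
Proof.
move=> Tl Tb x x1; apply/ler_addgt0Pr => e e0.
set w := w_A dot A T; have w0 : 0 <= w by exact: w_A_ge0.
(* [numerical_bound_sqr] asks for a positive constant while [w] may be 0. Since [d <= 1], (w + d)^2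
   <= w^2 + d (2 w + 1) <= w^2 + e. *)
set d := Num.min 1 (e / (2 * w + 1)).
have w1 : 0 < 2 * w + 1 by lra.
have d0 : 0 < d by rewrite lt_min ltr01 divr_gt0.
have d1 : d <= 1 by rewrite ge_min lexx.
have de : d * (2 * w + 1) <= e by rewrite -ler_pdivlMr // ge_min lexx orbT.
have := @numerical_bound_sqr _ _ _ gP T (w + d) Tl _ _ x.
rewrite x1 mulr1 => wd; apply: le_trans (wd _ _) _; first lra.
  move=> y; apply: le_trans (w_A_bound y Tl Tb) _.
  by rewrite ler_wpM2r ?(q_ge0 gP) // lerDl ltW.
nra.
Qed.

Lemma w_Ae_lower B C : linear B -> linear C ->
    numerically_bounded B -> numerically_bounded C ->
  2^-1 * w_A dot A ((B \o B) + (C \o C)) +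
    2^-1 * Num.max (w_A dot A B) (w_A dot A C) *
      `|w_A dot A (B + C) - w_A dot A (B - C)|
    <= w_Ae dot A B C ^+ 2.
Proof.
move=> Bl Cl Bb Cb.
have Sb : numerically_bounded (B + C) by exact: numerically_boundedD.
have Db : numerically_bounded (B - C).
  by apply: numerically_boundedD => //; exact: numerically_boundedN.
have Sl : linear (B + C).
  by move=> a u v; rewrite /= !addrfctE Bl Cl scalerDr addrACA.
have Dl : linear (B - C).
  by move=> a u v; rewrite /= !addrfctE !opprfctE Bl Cl scalerDr opprD scalerN addrACA.
have pw x := @w_A_sqr _ Sl Sb x; have rw x := @w_A_sqr _ Dl Db x.
have ps x := @w_A_ge _ x Sb; have rs x := @w_A_ge _ x Db.
have p0 := w_A_ge0 Sb; have r0 := w_A_ge0 Db.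
have E_bound T : numerically_bounded T ->
    (forall x, Re `|g (T x) x| <= Re `|g (B x) x| + Re `|g (C x) x|) ->
    w_A dot A T ^+ 2 <= 2 * w_Ae dot A B C ^+ 2.
  move=> Tb TBC; set E := w_Ae _ _ _ _ ^+ 2.
  have E0 : 0 <= 2 * E by rewrite mulr_ge0 ?sqr_ge0.
  rewrite -[leRHS](sqr_sqrtr E0) ler_sqr ?nnegrE ?sqrtr_ge0 ?w_A_ge0 //.
  apply: w_A_le => x x1.
  rewrite -ler_sqr ?nnegrE ?sqrtr_ge0 ?modulus_ge0 // sqr_sqrtr //.
  have := w_Ae_ge Bb Cb x1; rewrite -/E; have := TBC x.
  have := modulus_ge0 (g (T x) x).
  move: (Re `|_|) (Re `|_|) (Re `|_|) => t b c c0 cbt btE.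
  have : c ^+ 2 <= (b + t) ^+ 2 by rewrite ler_sqr ?nnegrE // (le_trans c0).
  have := sqr_ge0 (b - t); rewrite sqrrB sqrrD; lra.
have pE : w_A dot A (B + C) ^+ 2 <= 2 * w_Ae dot A B C ^+ 2.
  by apply: E_bound => // x; rewrite (siDl gP); exact: modulusD.
have rE : w_A dot A (B - C) ^+ 2 <= 2 * w_Ae dot A B C ^+ 2.
  apply: E_bound => // x; rewrite (siDl gP) (siNl gP) -(normrN (g (C x) x)).
  exact: modulusD.
set p := w_A dot A (B + C) in p0 pE ps pw *.
set r := w_A dot A (B - C) in r0 rE rs rw *.
have n2 : Re `|2%:C : R[i]| = 2.
  by rewrite normc_def /= expr0n addr0 sqrtr_sqr ger0_norm.
have W : w_A dot A ((B \o B) + (C \o C)) <= 2^-1 * (p ^+ 2 + r ^+ 2).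
  apply: w_A_le => x x1.
  have h : Re `|2%:C * g (((B \o B) + (C \o C)) x) x| <= p ^+ 2 + r ^+ 2.
    apply: le_trans (lerD (pw x x1) (rw x x1)).
    apply: le_trans (modulusD _ _); rewrite le_eqVlt; apply/orP; left; apply/eqP.
    congr (Re `|_|).
    rewrite /= !addrfctE !opprfctE /=.
    rewrite !(linear_add Bl, linear_add Cl, linear_opp Bl, linear_opp Cl).
    rewrite !(siDl gP, siNl gP) rmorphMn /=; ring.
  move: h; rewrite modulusM n2; lra.
have M : Num.max (w_A dot A B) (w_A dot A C) <= 2^-1 * (p + r).
  rewrite ge_max; apply/andP; split; apply: w_A_le => x x1.
    have := lerD (ps x x1) (rs x x1) => /(le_trans (modulusD _ _)).
    have -> : g ((B + C) x) x + g ((B - C) x) x = 2%:C * g (B x) x.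
      by rewrite !(siDl gP, siNl gP) rmorphMn /=; ring.
    by rewrite modulusM n2; lra.
  have := lerD (ps x x1) (rs x x1); rewrite -(normrN (g ((B - C) x) x)).
  move=> /(le_trans (modulusD _ _)).
  have -> : g ((B + C) x) x - g ((B - C) x) x = 2%:C * g (C x) x.
    by rewrite !(siDl gP, siNl gP) rmorphMn /=; ring.
  by rewrite modulusM n2; lra.
have M0 : 0 <= Num.max (w_A dot A B) (w_A dot A C) by rewrite le_max w_A_ge0.
(* For [r <= p] the bounds [W] and [M] leave (p^2 + r^2)/4 + (p + r)(p - r)/4 = p^2/2, which [pE]
   controls. The other case is symmetric, with [rE]. *)
have [pr|pr] := leP r p.
  rewrite ger0_norm ?subr_ge0 //; nra.
rewrite ltr0_norm ?subr_lt0 //; nra.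
Qed.

End NumericalRadius.

(** * Operators with an A-adjoint *)

(** After squaring this is (p - r)^2 >= 0; it is the source of the factor 1 / sqrt 2 in the upper
    bound. *)
Lemma sum_le_sqrt (R : rcfType) (p r : R) : 0 <= p -> 0 <= r ->
  2^-1 * (p + r) * Num.sqrt 2 <= Num.sqrt (p ^+ 2 + r ^+ 2).
Proof.
move=> p0 r0; rewrite -ler_sqr ?nnegrE ?mulr_ge0 ?sqrtr_ge0 ?addr_ge0 ?invr_ge0 //.
rewrite exprMn !sqr_sqrtr ?addr_ge0 ?sqr_ge0 //.
have := sqr_ge0 (p - r); nra.
Qed.

Section AdjointPair.
Variables (R : realType) (H : completeNormedModType R[i]) (dot : {dot H for conjC}).
Hypothesis dot_norm : induces_norm dot.
Variable A : H -> H.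
Hypothesis A_pos : positive_operator dot A.
Local Notation g := (dotA dot A).
Local Notation q x := (Re (g x x)).
Local Notation nrm x := (Re `|x|).
Let gP : semi_inner g := dotA_semi_inner A_pos.

Lemma q_le_norm : exists2 K : R, 0 <= K & forall x, q x <= K * nrm x ^+ 2.
Proof.
have [/bounded_operatorP[_ [K K0 AK]] _] := A_pos; exists K => // x.
apply: le_trans (Re_le_modulus _) _; apply: le_trans (CauchySchwarz_dot dot_norm _ _) _.
by rewrite expr2 mulrA ler_wpM2r ?nrm_ge0.
Qed.

(* Iterating Cauchy-Schwarz, [q (W^N x)^2 <= q (W^(2N) x) * q x], transfers the
   operator norm bound on [W] to the seminorm of [A]. *)
Lemma A_symmetric_bounded (W : H -> H) : bounded_operator W ->
  (forall x y, g (W x) y = g x (W y)) -> A_bounded dot A W.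
Proof.
move=> /bounded_operatorP[Wl [K K0 WK]] Wsym.
have [L L0 qL] := q_le_norm.
set k := K + 1; have k0 : 0 < k by rewrite ltr_wpDl.
have Wk n x : nrm (iter n W x) <= k ^+ n * nrm x.
  elim: n => [|n IH]; first by rewrite expr0 mul1r.
  rewrite iterS (le_trans (WK _)) // exprS -mulrA ler_pM ?nrm_ge0 //.
  by rewrite lerDl.
have Wn n x y : g (iter n W x) y = g x (iter n W y).
  by elim: n y => [//|n IH] y; rewrite iterS Wsym IH -iterSr.
have Wsq n x : q (iter n W x) ^+ 2 <= q (iter (n + n) W x) * q x.
  have h0 := q_ge0 gP (iter n W x).
  apply: (@le_trans _ _ (Re `|g x (iter (n + n) W x)| ^+ 2)).
    rewrite ler_sqr ?nnegrE ?modulus_ge0 // Wn -iterD; exact: Re_le_modulus.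
  by rewrite mulrC; exact: CauchySchwarz_si.
exists (k ^+ 2) => [|x]; first exact: sqr_ge0.
have [x0|x0] := eqVneq (q x) 0.
  have := Wsq 1%N x; rewrite x0 !mulr0 => h.
  have /eqP : q (W x) ^+ 2 == 0 by rewrite eq_le h sqr_ge0.
  by move=> /eqP; rewrite sqrf_eq0 => /eqP ->.
have qx : 0 < q x by rewrite lt_def x0 (q_ge0 gP).
rewrite -ler_pdivrMr //.
(* The ratio of seminorms along the powers 2^n at least squares at each step. Its growth bound has a
   constant depending on [x], but the rate [k ^+ 2] does not. *)
apply: (@squaring_growth _ (fun n => q (iter (2 ^ n) W x) / q x)
  (L * nrm x ^+ 2 / q x) (k ^+ 2)) => [|n|n|n].
- by rewrite exprn_gt0.
- by rewrite divr_ge0 ?(q_ge0 gP). 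
- rewrite expr_div_n expnS mul2n -addnn ler_pdivrMr ?exprn_gt0 //.
  by rewrite (expr2 (q x)) mulrA divfK.
- rewrite mulrAC ler_wpM2r ?invr_ge0 ?(q_ge0 gP) //.
  apply: le_trans (qL _) _; rewrite -mulrA ler_wpM2l // mulrC -exprM mulnC exprM.
  by rewrite -exprMn ler_sqr ?nnegrE ?mulr_ge0 ?exprn_ge0 ?nrm_ge0 ?(ltW k0).
Qed.

(** [X \o T] is symmetric for the form, hence A-bounded, and q (T x) = <X (T x), x>_A is estimated
    by Cauchy-Schwarz. *)
Lemma A_adjoint_pair_bounded (T X : H -> H) : bounded_operator T ->
    bounded_operator X -> (forall x y, g (X x) y = g x (T y)) ->
  A_bounded dot A T.
Proof.
move=> Tb Xb XT.
have TX x y : g (T x) y = g x (X y) by rewrite (siC gP) -XT -(siC gP).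
have [c c0 Wc] : A_bounded dot A (X \o T).
  apply: A_symmetric_bounded => [|x y /=]; first exact: bounded_operator_comp.
  by rewrite XT TX.
exists (Num.sqrt c) => [|x]; first exact: sqrtr_ge0.
rewrite -ler_sqr ?nnegrE ?mulr_ge0 ?sqrtr_ge0 ?(q_ge0 gP) // exprMn sqr_sqrtr //.
apply: (@le_trans _ _ (Re `|g (X (T x)) x| ^+ 2)).
  by rewrite ler_sqr ?nnegrE ?modulus_ge0 ?(q_ge0 gP) // XT; exact: Re_le_modulus.
apply: le_trans (CauchySchwarz_si gP _ _) _.
by rewrite expr2 mulrA ler_wpM2r ?(q_ge0 gP) //; exact: Wc.
Qed.

(** If [q] vanished identically, so would the whole form by Cauchy-Schwarz, and [A] would be 0. Any
    other vector can be normalized. *)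
Lemma unit_vector_exists : A != 0 -> exists x, q x = 1.
Proof.
move=> /eqP A0; have [x xn0] : exists x, q x != 0.
  apply: contrapT => nx; apply: A0; apply/funext => x.
  apply: (@dot_inj _ _ dot) => v.
  rewrite (siC (dot_semi_inner dot)) (siC (dot_semi_inner dot) 0).
  congr conjC; rewrite (si0 (dot_semi_inner dot)).
  apply/eqP; rewrite -normr_eq0 modulusE eq_complex /= eqxx andbT -sqrf_eq0.
  rewrite eq_le sqr_ge0 andbT; apply: le_trans (CauchySchwarz_si gP x v) _.
  have -> : q x = 0 by apply: contrapT => /eqP ?; apply: nx; exists x.
  by rewrite mul0r.
have qx : 0 < q x by rewrite lt_def xn0 (q_ge0 gP).
exists ((Num.sqrt (q x))^-1%:C *: x).
by rewrite (qZ gP) sqr_modulus /= expr0n addr0 exprVn sqr_sqrtr ?mulVf // ltW.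
Qed.

(** * The upper bound, with [X] and [Y] as A-adjoints of [B] and [C] *)

Section Upper.
Variables (B C X Y : H -> H).
Hypothesis unitA : exists x, q x = 1.
Hypotheses (Bb : A_bounded dot A B) (Cb : A_bounded dot A C).
Hypotheses (Xb : A_bounded dot A X) (Yb : A_bounded dot A Y).
Hypotheses (XB : forall x y, g (X x) y = g x (B y)).
Hypotheses (YC : forall x y, g (Y x) y = g x (C y)).

Lemma mean_bound (T S : H -> H) : (forall x y, g (S x) y = g x (T y)) ->
  forall x, q x = 1 -> Re `|g (T x) x| ^+ 2 <= 2^-1 * (q (T x) + q (S x)).
Proof.
move=> ST x x1; have h1 := CauchySchwarz_si gP (T x) x.
have h2 := CauchySchwarz_si gP (S x) x.
rewrite x1 !mulr1 in h1 h2.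
have E : Re `|g (S x) x| = Re `|g (T x) x| by rewrite ST (siC gP) norm_conjC.
rewrite E in h2; lra.
Qed.

Lemma w_Ae_upper : w_Ae dot A B C ^+ 2 <= (Num.sqrt 2)^-1 *
  w_A dot A (((X \o B) + (Y \o C)) + 'i%C *: ((B \o X) + (C \o Y))).
Proof.
set T := _ + 'i%C *: _.
have Tb : numerically_bounded dot A T.
  by do ?[apply: (numerically_boundedD gP) | apply: (numerically_boundedZ gP)];
    apply: (A_bounded_numerically gP); apply: A_bounded_comp.
apply: (w_Ae_sqr_le gP unitA) => x x1.
have := w_A_ge gP Tb x1.
set p := q (B x) + q (C x); set r := q (X x) + q (Y x).
(* Moving one factor across the form turns <X (B x), x>_A into q (B x) and <B (X x), x>_A into q (X
   x), and likewise for [C] and [Y]. *)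
have -> : g (T x) x = p +i* r.
  have BX y : g (B (X x)) y = g (X x) (X y) by rewrite (siC gP) -XB -(siC gP).
  have CY y : g (C (Y x)) y = g (Y x) (Y y) by rewrite (siC gP) -YC -(siC gP).
  rewrite /T !addrfctE /= (siDl gP) (siZl gP) !(siDl gP) XB YC BX CY.
  rewrite (si_diag gP (B x)) (si_diag gP (C x)) (si_diag gP (X x)) (si_diag gP (Y x)).
  by apply: complex_eq; rewrite !ReImE /= /p /r; ring.
rewrite normc_def /= => wT.
have p0 : 0 <= p by rewrite addr_ge0 ?(q_ge0 gP).
have r0 : 0 <= r by rewrite addr_ge0 ?(q_ge0 gP).
have s2 : 0 < Num.sqrt 2 :> R by rewrite sqrtr_gt0.
rewrite mulrC ler_pdivlMr //; apply: le_trans wT.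
apply: le_trans (sum_le_sqrt p0 r0); rewrite ler_pM2r //.
apply: le_trans (lerD (mean_bound XB x1) (mean_bound YC x1)) _.
by rewrite -mulrDr addrACA.
Qed.

End Upper.
End AdjointPair.

Theorem theorem2p6 (R : realType) (H : completeNormedModType R[i])
    (dot : {dot H for conjC}) (dot_norm : induces_norm dot)
    (A : H -> H) (A_pos : positive_operator dot A) (A_neq0 : A != 0)
    (B C : H -> H)
    (B_adj : A_adjointable dot A B) (C_adj : A_adjointable dot A C) :
  2^-1 * w_A dot A ((B \o B) + (C \o C)) +
    2^-1 * Num.max (w_A dot A B) (w_A dot A C) *
      `|w_A dot A (B + C) - w_A dot A (B - C)|
    <= w_Ae dot A B C ^+ 2
  /\
  w_Ae dot A B C ^+ 2
    <= (Num.sqrt 2)^-1 *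
       w_A dot A (((sharp dot A B \o B) + (sharp dot A C \o C)) +
                  'i%C *: ((B \o sharp dot A B) + (C \o sharp dot A C))).
Proof.
have gP := dotA_semi_inner A_pos.
have unitA := unit_vector_exists A_pos A_neq0.
have [Bb [Xb XB]] := (B_adj.1, sharpP dot_norm A_pos B_adj).
have [Cb [Yb YC]] := (C_adj.1, sharpP dot_norm A_pos C_adj).
(* The adjoint relation is symmetric, so the same lemma also bounds the A-adjoints. *)
have BX x y : dotA dot A (B x) y = dotA dot A x (sharp dot A B y).
  by rewrite (siC gP) -XB -(siC gP).
have CY x y : dotA dot A (C x) y = dotA dot A x (sharp dot A C y).
  by rewrite (siC gP) -YC -(siC gP).
have BA := A_adjoint_pair_bounded dot_norm A_pos Bb Xb XB.
have CA := A_adjoint_pair_bounded dot_norm A_pos Cb Yb YC.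
have XA := A_adjoint_pair_bounded dot_norm A_pos Xb Bb BX.
have YA := A_adjoint_pair_bounded dot_norm A_pos Yb Cb CY.
split; last exact: w_Ae_upper.
by apply: w_Ae_lower => //; by [case: Bb | case: Cb | exact: A_bounded_numerically].
Qed.
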